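(* For every finite simple graph $G$ with at least one vertex, $$\alpha_2(G)\geq Z_3(G)=\sum_{v\in V(G)}\min\left\{1,\frac{1}{\zeta(v)+\frac13}\right\}.$$
   Context: For an integer $k\geq 0$, a $k$-independent set of $G$ is a set $S\subseteq V(G)$ with $\Delta(G[S])\leq k$, and $\alpha_k(G)$ is the maximum cardinality of a $k$-independent set. For a vertex $v$, $\zeta(v)=\max_H\delta(H)$, the maximum over all subgraphs $H$ of $G$ containing $v$, where $\delta(H)$ is the minimum degree. *)

(* Defs.v *)
From mathcomp Require Import all_boot all_order all_algebra.

Set Implicit Arguments.
Unset Strict Implicit.
Unset Printing Implicit Defensive.

Import Order.TTheory GRing.Theory Num.Theory.

Record sgraph := SGraph {
  vertex :> finType;
  adj : rel vertex;
  adj_sym : symmetric adj;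
  adj_irr : irreflexive adj }.

Definition edges (G : sgraph) : {set {set G}} :=
  [set f | [exists x, exists y, adj x y && (f == [set x; y])]].

(* A pair (vertex set, edge set), in a finite type so that one can maximise
   over subgraphs; such a pair is meaningful only when [is_subgraph] holds.
   Subgraphs need not be induced. *)
Definition presub (G : sgraph) : finType := ({set G} * {set {set G}})%type.

Definition is_subgraph (G : sgraph) (H : presub G) : bool :=
  (H.2 \subset edges G) && [forall f in H.2, f \subset H.1].

Definition induced (G : sgraph) (S : {set G}) : presub G :=
  (S, [set f in edges G | f \subset S]).

Definition degree (G : sgraph) (H : presub G) (x : G) : nat :=
  #|[set y | [set x; y] \in H.2]|.

Definition max_degree (G : sgraph) (H : presub G) : nat :=
  \max_(x in H.1) degree H x.

(* The default value #|G| exceeds every degree in a subgraph, so it is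
   irrelevant as soon as H has a vertex. *)
Definition min_degree (G : sgraph) (H : presub G) : nat :=
  \big[minn/#|{: G}|]_(x in H.1) degree H x.

Definition k_independent (k : nat) (G : sgraph) (S : {set G}) : bool :=
  max_degree (induced S) <= k.

Definition alpha (k : nat) (G : sgraph) : nat :=
  \max_(S : {set G} | k_independent k S) #|S|.

Definition zeta (G : sgraph) (v : G) : nat :=
  \max_(H : presub G | is_subgraph H && (v \in H.1)) min_degree H.

Local Open Scope ring_scope.

Definition Z3 (G : sgraph) : rat :=
  \sum_(v : G) Num.min 1 (1 / ((zeta v)%:R + 1 / 3%:R)).

(* Main.v *)
(* Let [X] be a minimal counterexample, for the weights [min 1 (1/(zeta + 1/3))].
   It has no 2-independent set [S] whose closed neighbourhood weighs at most #|S|.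
   Suppose first that [X] has minimum degree k >= 1, so that every weight is at
   most 3/(3k+1); then a set of s vertices whose closed neighbourhood has at most
   s(k + 1/3) elements is a reducible configuration if it is 2-independent.
   Applied to vertices of degree k, and to pairs consisting of a vertex of degree
   k and an adjacent one of degree k+1, this shows that after removal of the
   vertices of degree k the minimum degree is at least k+1.  Hence the weights of
   the remaining vertices are at most 3/(3k+4), and for k >= 3 any vertex of degree
   k is reducible, so there was none.  For k = 1 and k = 2 the removed vertices
   form a sparse set [A] attached to the rest, and all the configurations remain
   reducible in the presence of [A].  So the argument runs through k = 1, 2, 3 and
   then shows that the 3-core is empty; going back, so is [X]. *)
Require Import Defs.
From mathcomp Require Import all_boot all_order all_algebra.
From mathcomp Require Import zify ring lra.

Set Implicit Arguments.
Unset Strict Implicit.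
Unset Printing Implicit Defensive.

Import Order.TTheory GRing.Theory Num.Theory.

(** Only facts moved into the goal are kept. Cardinals become variables, so [nia] sees plain
    arithmetic over [nat]. *)
Ltac card_nia := clear;
  repeat match goal with |- context [@card ?T ?A] => move: (@card T A) => ? end;
  nia.

(** * Unions of sets with known common elements *)

Section SetLemmas.
Variables (V : finType) (A B : {set V}).

Lemma card_setU_common1 x :
  x \in A -> x \in B -> #|A :|: B| + 1 <= #|A| + #|B|.
Proof.
move=> xA xB; have := cardsUI A B.
have : 0 < #|A :&: B| by apply/card_gt0P; exists x; rewrite inE xA.
lia.
Qed.

Lemma card_setU_common2 x y : x != y ->
  x \in A -> x \in B -> y \in A -> y \in B -> #|A :|: B| + 2 <= #|A| + #|B|.
Proof.
move=> xy xA xB yA yB; have := cardsUI A B.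
have : #|[set x; y]| <= #|A :&: B|.
  by apply/subset_leq_card/subsetP=> z /set2P[]->; rewrite inE ?xA ?yA.
by rewrite cards2 xy /=; lia.
Qed.

Lemma card_setU_common3 x y z : x != y -> z != x -> z != y ->
  x \in A -> x \in B -> y \in A -> y \in B -> z \in A -> z \in B ->
  #|A :|: B| + 3 <= #|A| + #|B|.
Proof.
move=> xy zx zy xA xB yA yB zA zB; have := cardsUI A B.
have : #|z |: [set x; y]| <= #|A :&: B|.
  apply/subset_leq_card/subsetP=> t; rewrite !inE.
  by case/or3P=> /eqP->; apply/andP.
by rewrite cardsU1 !inE cards2 xy (negPf zx) (negPf zy) /=; lia.
Qed.

End SetLemmas.

(** * Sums of nonnegative weights *)

Section SumLemmas.
Local Open Scope ring_scope.
Variables (V : finType) (w : V -> rat).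
Hypothesis w_ge0 : forall v, 0 <= w v.

Lemma sum_setU_le (A B : {set V}) :
  \sum_(x in A :|: B) w x <= \sum_(x in A) w x + \sum_(x in B) w x.
Proof.
rewrite (big_setID A) /= (setIidPr (subsetUl A B)) lerD2l setDUl setDv set0U.
rewrite [leRHS](big_setID A) /= lerDr.
by apply: sumr_ge0.
Qed.

Lemma sum_subset_le (A B : {set V}) : A \subset B ->
  \sum_(x in A) w x <= \sum_(x in B) w x.
Proof.
move=> AB; rewrite [leRHS](big_setID A) /= (setIidPr AB) lerDl.
by apply: sumr_ge0.
Qed.

Lemma sum_bigcup_le (I : finType) (P : {set I}) (F : I -> {set V}) :
  \sum_(x in \bigcup_(i in P) F i) w x <= \sum_(i in P) \sum_(x in F i) w x.
Proof.
pose K (U : {set V}) s := \sum_(x in U) w x <= s.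
apply: (big_ind2 K) => [|A a B b Aa Bb|i _] /=; rewrite /K ?big_set0 //.
by apply: le_trans (sum_setU_le A B) _; apply: lerD.
Qed.

Lemma sum_le_card (A : {set V}) c :
  (forall x, x \in A -> w x <= c) -> \sum_(x in A) w x <= #|A|%:R * c.
Proof.
move=> wc; apply: le_trans (ler_sum _ wc) _.
by rewrite sumr_const mulr_natl.
Qed.

End SumLemmas.

(** * Numerical bounds on weights *)

Section Weights.
Local Open Scope ring_scope.

(** This is [1 / (k + 1/3)], written with integer numerator and denominator. *)
Definition wt (k : nat) : rat := 3%:R / (3 * k + 1)%N%:R.

(** Clearing denominators turns each bound mixing two consecutive weights into a polynomial
    inequality over [nat]. *)
Lemma wt_comb_le n m c d k : (0 < d)%N ->
  (d * (3 * n * (3 * k + 4) + 3 * m * (3 * k + 1))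
     <= c * (3 * k + 1) * (3 * k + 4))%N ->
  n%:R * wt k + m%:R * wt k.+1 <= c%:R / d%:R.
Proof.
move=> d0 le_nat; rewrite /wt.
have -> : (3 * k.+1 + 1 = 3 * k + 4)%N by lia.
move: le_nat; set x := (3 * k + 1)%N; set y := (3 * k + 4)%N => le_nat.
have [x0 y0] : (0 < x)%N /\ (0 < y)%N by rewrite /x /y !addnS.
have [xR yR dR] : [/\ 0 < x%:R :> rat, 0 < y%:R :> rat & 0 < d%:R :> rat].
  by rewrite !ltr0n.
rewrite ler_pdivlMr // !mulrA addf_div ?gt_eqF // mulrAC.
rewrite ler_pdivrMr ?mulr_gt0 // -!natrM -!natrD -!natrM ler_nat.
by move: le_nat; clear; nia.
Qed.

End Weights.

(** * Neighbourhoods relative to a vertex set *)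

Section Graph.
Variables (V : finType) (e : rel V).
Hypotheses (e_sym : symmetric e) (e_irr : irreflexive e).

Definition nbrs (C : {set V}) x := [set y in C | e x y].
Definition clnbrs (C : {set V}) x := x |: nbrs C x.
Definition clnbrs_set (C S : {set V}) := \bigcup_(x in S) clnbrs C x.

Lemma in_nbrs C x y : (y \in nbrs C x) = (y \in C) && e x y.
Proof. by rewrite inE. Qed.

Lemma in_clnbrs C x y : (y \in clnbrs C x) = (y == x) || (y \in C) && e x y.
Proof. by rewrite !inE. Qed.

Lemma clnbrs_refl C x : x \in clnbrs C x.
Proof. by rewrite in_clnbrs eqxx. Qed.

Lemma adj_neq x y : e x y -> x != y.
Proof. by apply: contraTneq => ->; rewrite e_irr. Qed.

Lemma card_clnbrs C x : #|clnbrs C x| = #|nbrs C x|.+1.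
Proof. by rewrite cardsU1 in_nbrs e_irr andbF. Qed.

Lemma clnbrs_setU C S T :
  clnbrs_set C (S :|: T) = clnbrs_set C S :|: clnbrs_set C T.
Proof. exact: bigcup_setU. Qed.

Lemma clnbrs_set1 C x : clnbrs_set C [set x] = clnbrs C x.
Proof. exact: big_set1. Qed.

Lemma clnbrs_set_sub (C S : {set V}) : S \subset C -> clnbrs_set C S \subset C.
Proof.
move=> /subsetP SC; apply/bigcupsP=> x xS; apply/subsetP=> y.
by rewrite in_clnbrs => /predU1P[->|/andP[]//]; apply: SC.
Qed.

Lemma sub_clnbrs_set (C S : {set V}) : S \subset clnbrs_set C S.
Proof.
by apply/subsetP=> x xS; apply/bigcupP; exists x; rewrite ?clnbrs_refl.
Qed.

Lemma nbrsU (A B : {set V}) x : nbrs (A :|: B) x = nbrs A x :|: nbrs B x.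
Proof. by apply/setP=> y; rewrite !inE andb_orl. Qed.

Lemma nbrs_subset (A B : {set V}) x : A \subset B -> nbrs A x \subset nbrs B x.
Proof.
by move=> /subsetP AB; apply/subsetP=> y; rewrite !inE => /andP[/AB-> ->].
Qed.

Lemma card_nbrs_lt (S : {set V}) x : x \in S -> #|nbrs S x| < #|S|.
Proof.
move=> xS; apply/proper_card/properP; split.
  by apply/subsetP=> y; rewrite in_nbrs => /andP[].
by exists x; rewrite // in_nbrs e_irr andbF.
Qed.

Lemma card_nbrs_lt2 (S : {set V}) x y : x \in S -> y \in S -> y != x ->
  ~~ e x y -> #|nbrs S x| + 1 < #|S|.
Proof.
move=> xS yS yx exy; have /subset_leq_card : nbrs S x \subset S :\ x :\ y.
  apply/subsetP=> z; rewrite !inE => /andP[-> exz].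
  rewrite [z == x]eq_sym (adj_neq exz) !andbT.
  by apply: contraNneq exy => <-.
have := cardsD1 x S; have := cardsD1 y (S :\ x).
by rewrite xS !inE yx yS /=; lia.
Qed.

Variable w : V -> rat.
Local Open Scope ring_scope.
Hypotheses (w_ge0 : forall v, 0 <= w v) (w_le1 : forall v, w v <= 1).

(** Together with the bounds 0 and 1, this is all that the argument uses of [zeta]. *)
Hypothesis w_core : forall (k : nat) (Y : {set V}),
  (forall v, v \in Y -> (k <= #|nbrs Y v|)%N) ->
  forall v, v \in Y -> w v <= wt k.

(* What minimality of a counterexample [X] gives: otherwise [S] together with a
   solution for [X :\: T] would be a solution for [X]. *)
Definition irreducible (X : {set V}) := forall S T : {set V},
  S \subset T -> T \subset X -> T != set0 ->
  (forall x, x \in S -> (#|nbrs S x| <= 2)%N) ->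
  (forall x, x \in S -> nbrs X x \subset T) ->
  ~ \sum_(x in T) w x <= #|S|%:R.

(** * Reducible configurations in the presence of stripped vertices *)

Section Irreducible.
Variable X : {set V}.
Hypothesis X_irr : irreducible X.

(* [C] has minimum degree at least [k]; [A] consists of the vertices stripped
   off earlier.  Once one vertex of [C] near [a \in A] is discarded, taking [a]
   into the 2-independent set and discarding its neighbours costs at most
   3/4 < 1. *)
Record level (k : nat) (C A : {set V}) : Prop := Level {
  level_part : C :|: A = X;
  level_disj : [disjoint C & A];
  level_mindeg : forall v, v \in C -> (k <= #|nbrs C v|)%N;
  level_indep : forall a, a \in A -> nbrs A a = set0;
  level_attach : forall u, u \in C -> (#|nbrs A u| <= 1)%N;
  level_deg2 : forall a, a \in A -> (#|nbrs C a| <= 2)%N;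
  level_cost : forall a u, a \in A -> u \in nbrs C a ->
    w a + \sum_(x in nbrs C a :\ u) w x <= 3%:R / 4%:R }.

Section Level.
Variables (k : nat) (C A : {set V}).
Hypothesis L : level k C A.

Definition attached (T : {set V}) := [set a in A | [exists u in T, e a u]].

(* All vertices of [A] attached to the discarded part join [S]: each brings 1 and
   costs at most 3/4. *)
Lemma reduce (S : {set V}) : S \subset C -> S != set0 ->
  (forall x, x \in S -> (#|nbrs S x| + #|nbrs A x| <= 2)%N) ->
  ~ \sum_(x in clnbrs_set C S) w x
      <= #|S|%:R + #|attached (clnbrs_set C S)|%:R / 4%:R.
Proof.
move=> SC S0 deg; set T0 := clnbrs_set C S; set B := attached T0.
have T0C : T0 \subset C := clnbrs_set_sub SC.
have ST0 : S \subset T0 := sub_clnbrs_set C S.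
have BA : B \subset A by apply/subsetP=> a; rewrite inE => /andP[].
have [CX AX] : C \subset X /\ A \subset X.
  by rewrite -(level_part L) subsetUl subsetUr.
have nX x : nbrs X x = nbrs C x :|: nbrs A x by rewrite -(level_part L) nbrsU.
(* Discarding [F a] for each attached [a] makes [T] contain all neighbours of [S :|: B] in [X]. *)
pose F a := a |: (nbrs C a :\: T0).
pose T := T0 :|: \bigcup_(a in B) F a.
have BT : B \subset T.
  apply/subsetP=> a aB; rewrite inE; apply/orP; right.
  by apply/bigcupP; exists a; rewrite // !inE eqxx.
have nBX a : a \in B -> nbrs X a = nbrs C a.
  by move=> /(subsetP BA) aA; rewrite nX (level_indep L aA) setU0.
move=> le_w; apply: (@X_irr (S :|: B) T).
- by rewrite subUset BT andbT (subset_trans ST0) ?subsetUl.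
- rewrite subUset (subset_trans T0C CX) /=; apply/bigcupsP=> a aB.
  rewrite subUset sub1set (subsetP AX) ?(subsetP BA) //=.
  apply/subsetP=> x; rewrite !inE => /and3P[_ xC _].
  exact: (subsetP CX).
- by apply: contraNneq S0 => T_0; rewrite -subset0 -T_0 (subset_trans ST0) ?subsetUl.
- move=> x /setUP[xS|xB].
    rewrite nbrsU (leq_trans (leq_card_setU _ _)) // (leq_trans _ (deg x xS)) //.
    by rewrite leq_add2l subset_leq_card ?nbrs_subset.
  rewrite (leq_trans _ (level_deg2 L (subsetP BA x xB))) // -nBX //.
  rewrite subset_leq_card // nbrs_subset // subUset (subset_trans SC CX).
  exact: subset_trans BA AX.
- move=> x /setUP[xS|xB].
    rewrite nX subUset; apply/andP; split.
      apply: subset_trans (subsetUl _ _); apply: subset_trans (bigcup_sup x xS).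
      exact: subsetUr.
    apply: subset_trans BT; apply/subsetP=> a; rewrite !inE => /andP[-> exa] /=.
    by apply/existsP; exists x; rewrite (subsetP ST0) // e_sym.
  rewrite nBX //; apply/subsetP=> y yx; rewrite inE.
  have [//|yT0] /= := boolP (y \in T0).
  by apply/bigcupP; exists x; rewrite // !inE yT0 -in_nbrs yx orbT.
have -> : #|S :|: B| = (#|S| + #|B|)%N.
  rewrite cardsU; suff -> : S :&: B = set0 by rewrite cards0 subn0.
  by apply/eqP; rewrite setI_eq0 (disjointWl SC) ?(disjointWr BA) ?(level_disj L).
apply: le_trans (sum_setU_le w_ge0 _ _) _.
have : \sum_(x in \bigcup_(a in B) F a) w x <= #|B|%:R * (3%:R / 4%:R).
  apply: le_trans (sum_bigcup_le w_ge0 _ _) _.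
  rewrite mulr_natl -sumr_const; apply: ler_sum => a aB.
  have aA := subsetP BA a aB.
  (* Attachment provides a neighbour [u] of [a] already paid for in [T0], so [level_cost] bounds
     what [F a] adds. *)
  have [u uT0 eau] : exists2 u, u \in T0 & e a u.
    by move: aB; rewrite inE => /andP[_ /existsP[u /andP[]]]; exists u.
  have uCa : u \in nbrs C a by rewrite in_nbrs eau (subsetP T0C).
  apply: le_trans (level_cost L aA uCa).
  apply: le_trans (sum_setU_le w_ge0 _ _) _; rewrite big_set1 lerD2l.
  apply: sum_subset_le => //; apply/subsetP=> y; rewrite !inE => /and3P[yT0 -> ->].
  by rewrite !andbT; apply: contraNneq yT0 => ->.
by rewrite natrD; lra.
Qed.

(** Each discarded vertex of [C] weighs at most [3/(3k+1)]; the inequality is that of [reduce]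
    multiplied by [4 (3k+1)]. *)
Lemma reduce_card (S : {set V}) : S \subset C -> S != set0 ->
  (forall x, x \in S -> (#|nbrs S x| + #|nbrs A x| <= 2)%N) ->
  ~ (12 * #|clnbrs_set C S|
       <= (4 * #|S| + #|attached (clnbrs_set C S)|) * (3 * k + 1))%N.
Proof.
move=> SC S0 deg le_card; apply: (reduce SC S0 deg).
apply: le_trans (sum_le_card _) _.
  move=> x /(subsetP (clnbrs_set_sub SC)).
  by apply: w_core; apply: level_mindeg L.
have K0 : 0 < (3 * k + 1)%N%:R :> rat by rewrite ltr0n addn1.
rewrite mulrA ler_pdivrMr //; move: le_card; rewrite -(ler_nat rat).
rewrite !natrM natrD natrM.
set K := _%:R; lra.
Qed.

Lemma attached_card0 (T : {set V}) x :
  attached T = set0 -> x \in T -> #|nbrs A x| = 0%N.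
Proof.
move=> T0 xT; apply/eqP; rewrite cards_eq0 -subset0 -T0.
apply/subsetP=> a; rewrite !inE => /andP[-> exa] /=.
by apply/existsP; exists x; rewrite xT e_sym.
Qed.

(** Two vertices satisfy the degree condition automatically: each has at most one neighbour in the
    pair and one in [A]. *)
Lemma reduce_pair x y : x \in C -> y \in C -> x != y ->
  ~ (12 * #|clnbrs C x :|: clnbrs C y|
       <= (8 + #|attached (clnbrs C x :|: clnbrs C y)|) * (3 * k + 1))%N.
Proof.
move=> xC yC xy; have c2 : #|[set x; y]| = 2%N by rewrite cards2 xy.
have SC : [set x; y] \subset C by apply/subsetP=> z /set2P[]->.
have := @reduce_card [set x; y] SC; rewrite clnbrs_setU !clnbrs_set1 c2; apply.
  by apply/set0Pn; exists x; rewrite !inE eqxx.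
move=> z zS; have lt2 := card_nbrs_lt zS; rewrite c2 ltnS in lt2.
exact: leq_add lt2 (level_attach L (subsetP SC z zS)).
Qed.

(** In a triple a vertex may have two neighbours; to afford one more in [A] it must miss one of the
    triple. The gain from attached vertices is ignored in the count. *)
Lemma reduce_triple x y z : x \in C -> y \in C -> z \in C ->
  x != y -> z != x -> z != y ->
  (forall t, t \in [set x; y; z] -> #|nbrs A t| = 0%N \/
     exists s, [/\ s \in [set x; y; z], s != t & ~~ e t s]) ->
  ~ (#|clnbrs C x :|: clnbrs C y :|: clnbrs C z| <= 3 * k + 1)%N.
Proof.
move=> xC yC zC xy zx zy free le_card; set S := [set x; y; z].
have c3 : #|S| = 3%N by rewrite /S setUC cardsU1 cards2 !inE xy (negPf zx) (negPf zy).
have SC : S \subset C by apply/subsetP=> t; rewrite !inE => /orP[/orP[]|] /eqP->.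
have := @reduce_card S SC; rewrite !clnbrs_setU !clnbrs_set1 c3; apply.
- by apply/set0Pn; exists x; rewrite !inE eqxx.
- move=> t tS; have lt3 := card_nbrs_lt tS; rewrite c3 in lt3.
  have [->|[s [sS st est]]] := free t tS; first by rewrite addn0.
  have lt2 := card_nbrs_lt2 tS sS st est; rewrite c3 in lt2.
  rewrite addn1 !ltnS in lt2; have := level_attach L (subsetP SC t tS).
  exact: leq_add lt2.
- by move: le_card; card_nia.
Qed.

(** * Vertices of minimum degree *)

Definition low := [set v in C | #|nbrs C v| == k].

Lemma lowP v : v \in low -> v \in C /\ #|clnbrs C v| = k.+1.
Proof. by rewrite inE => /andP[-> /eqP d]; rewrite card_clnbrs d. Qed.

Lemma low_sub : low \subset C.
Proof. by apply/subsetP=> v /lowP[]. Qed.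

(** Two adjacent low vertices have at most [2(k+1) - 2 = 2k] closed neighbours, few enough for
    [reduce_pair]. *)
Lemma low_indep u v : u \in low -> v \in low -> ~~ e u v.
Proof.
move=> uD vD; apply/negP=> euv; have [[uC du] [vC dv]] := (lowP uD, lowP vD).
have uv := adj_neq euv; apply: (reduce_pair uC vC uv).
have uv1 : u \in clnbrs C v by rewrite in_clnbrs uC e_sym euv orbT.
have vu1 : v \in clnbrs C u by rewrite in_clnbrs vC euv orbT.
have := card_setU_common2 uv (clnbrs_refl C u) uv1 vu1 (clnbrs_refl C v).
by rewrite du dv; card_nia.
Qed.

(** The three closed neighbourhoods share [u], so their union has at most [3(k+1) - 2 = 3k+1]
    elements. *)
Lemma low_nbrs_lt3 u v1 v2 v3 : u \in C -> v1 \in low -> v2 \in low -> v3 \in low ->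
  v1 != v2 -> v3 != v1 -> v3 != v2 -> e u v1 -> e u v2 -> e u v3 -> False.
Proof.
move=> uC D1 D2 D3 n12 n31 n32 e1 e2 e3.
have [[[C1 d1] [C2 d2]] [C3 d3]] := (lowP D1, lowP D2, lowP D3).
have uN v : e u v -> u \in clnbrs C v.
  by move=> euv; rewrite in_clnbrs uC e_sym euv orbT.
apply: (reduce_triple C1 C2 C3 n12 n31 n32).
  move=> t; rewrite !inE => /orP[/orP[]|] /eqP->; right.
  - by exists v2; split; rewrite ?low_indep // 1?eq_sym // ?inE ?eqxx ?orbT.
  - by exists v1; split; rewrite ?low_indep // 1?eq_sym // ?inE ?eqxx ?orbT.
  - by exists v1; split; rewrite ?low_indep // 1?eq_sym // ?inE ?eqxx ?orbT.
have c12 := card_setU_common1 (uN _ e1) (uN _ e2).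
have u12 : u \in clnbrs C v1 :|: clnbrs C v2 by rewrite inE uN.
have := card_setU_common1 u12 (uN _ e3).
by move: c12; rewrite d1 d2 d3; card_nia.
Qed.

Hypothesis k_gt0 : (0 < k)%N.

Lemma low_nbrs_two u v1 v2 : u \in C -> v1 \in low -> v2 \in low -> v1 != v2 ->
  e u v1 -> e u v2 -> (k + 2 < #|nbrs C u|)%N.
Proof.
move=> uC D1 D2 n12 e1 e2; rewrite ltnNge; apply/negP=> du.
have [[C1 d1] [C2 d2]] := (lowP D1, lowP D2).
have uN v : e u v -> u \in clnbrs C v.
  by move=> euv; rewrite in_clnbrs uC e_sym euv orbT.
(* If [u] has no neighbour in [A], the path [v1], [u], [v2] is reducible. Otherwise the vertex of
   [A] attached to [u] pays, through its quarter, for the pair [v1], [v2]. *)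
have [Au|] := posnP #|nbrs A u|.
  have nu v : e u v -> u != v := @adj_neq u v.
  apply: (@reduce_triple v1 u v2) => //; first by rewrite eq_sym nu.
  - by rewrite eq_sym.
  - by rewrite eq_sym nu.
  - move=> t; rewrite !inE => /orP[/orP[]|] /eqP->; [right|left|right] => //.
    + by exists v2; split; rewrite ?low_indep // 1?eq_sym // ?inE ?eqxx ?orbT.
    + by exists v1; split; rewrite ?low_indep // 1?eq_sym // ?inE ?eqxx ?orbT.
  have vN v : v \in C -> e u v -> v \in clnbrs C u.
    by move=> vC euv; rewrite in_clnbrs vC euv orbT.
  have c1 := card_setU_common2 (nu _ e1) (uN _ e1) (clnbrs_refl C u)
    (clnbrs_refl C v1) (vN _ C1 e1).
  have uN1 : u \in clnbrs C v1 :|: clnbrs C u by rewrite in_setU clnbrs_refl orbT.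
  have v2N : v2 \in clnbrs C v1 :|: clnbrs C u by rewrite in_setU vN ?orbT.
  have := card_setU_common2 (nu _ e2) uN1 (uN _ e2) v2N (clnbrs_refl C v2).
  by move: c1 du; rewrite d1 d2 card_clnbrs; card_nia.
case/card_gt0P=> a; rewrite in_nbrs => /andP[aA eua].
apply: (reduce_pair C1 C2 n12).
have /card_gt0P : exists x, x \in attached (clnbrs C v1 :|: clnbrs C v2).
  exists a; rewrite inE aA; apply/existsP; exists u.
  by rewrite inE uN // e_sym.
have := card_setU_common1 (uN _ e1) (uN _ e2).
by move: k_gt0; rewrite d1 d2; card_nia.
Qed.

(** * A low vertex adjacent to one of degree one more *)

Definition pair u v := [&& u \in C, v \in low, #|nbrs C u| == k.+1 & e u v].

Lemma pairP u v : pair u v ->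
  [/\ u \in C, v \in C, v \in low, #|nbrs C u| = k.+1 & e u v].
Proof. by case/and4P=> uC vD /eqP du euv; have [vC _] := lowP vD. Qed.

(** A pair only just escapes [reduce_pair]: [12 (2k+1)] exceeds [8 (3k+1)] by 4. One common
    neighbour or one attached vertex closes the gap, as the next two lemmas exploit. *)
Lemma card_pair u v : pair u v -> (#|clnbrs C u :|: clnbrs C v| <= 2 * k + 1)%N.
Proof.
case/pairP=> uC vC /lowP[_ dv] du euv.
have uv1 : u \in clnbrs C v by rewrite in_clnbrs uC e_sym euv orbT.
have vu1 : v \in clnbrs C u by rewrite in_clnbrs vC euv orbT.
have := card_setU_common2 (adj_neq euv) (clnbrs_refl C u) uv1 vu1 (clnbrs_refl C v).
by rewrite card_clnbrs du dv; card_nia.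
Qed.

Lemma pair_no_triangle u v z : pair u v -> z \in C -> e u z -> ~~ e v z.
Proof.
case/pairP=> uC vC /lowP[_ dv] du euv zC euz; apply/negP=> evz.
have uv1 : u \in clnbrs C v by rewrite in_clnbrs uC e_sym euv orbT.
have vu1 : v \in clnbrs C u by rewrite in_clnbrs vC euv orbT.
have zu : z \in clnbrs C u by rewrite in_clnbrs zC euz orbT.
have zv : z \in clnbrs C v by rewrite in_clnbrs zC evz orbT.
have [nzu nzv] : z != u /\ z != v by rewrite !(eq_sym z) !adj_neq.
have := card_setU_common3 (adj_neq euv) nzu nzv
  (clnbrs_refl C u) uv1 vu1 (clnbrs_refl C v) zu zv.
rewrite card_clnbrs du dv => le_c.
by apply: (reduce_pair uC vC (adj_neq euv)); move: le_c; card_nia.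
Qed.

Lemma pair_attached u v : pair u v -> attached (clnbrs C u :|: clnbrs C v) = set0.
Proof.
move=> puv; have le_c := card_pair puv; case/pairP: puv => uC vC _ _ euv.
apply/eqP; rewrite -cards_eq0 -leqn0 leqNgt; apply/negP=> att.
by apply: (reduce_pair uC vC (adj_neq euv)); move: le_c att k_gt0; card_nia.
Qed.

Lemma pair_card0 u v x : pair u v -> x \in clnbrs C u :|: clnbrs C v ->
  #|nbrs A x| = 0%N.
Proof. by move/pair_attached; apply: attached_card0. Qed.

Lemma pair_low_uniq u v v' : pair u v -> v' \in low -> v' != v -> ~~ e u v'.
Proof.
case/pairP=> uC vC vD du euv v'D nv; apply/negP=> euv'.
by have := low_nbrs_two uC v'D vD nv euv' euv; rewrite du; card_nia.
Qed.

(** Otherwise [u], [v], [u'] form a reducible triple: [u'] adds only [k] vertices to the [2k+1] of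
    the pair. *)
Lemma pair_uniq u u' v : pair u v -> pair u' v -> u' = u.
Proof.
move=> p p'; apply/eqP; apply: contraT => nu.
have [uC vC vD du euv] := pairP p; have [u'C _ _ du' eu'v] := pairP p'.
have c := card_pair p.
have pf := pair_card0 p; have pf' := pair_card0 p'.
have vu' : v \in clnbrs C u' by rewrite in_clnbrs vC eu'v orbT.
have u'v : u' \in clnbrs C v by rewrite in_clnbrs u'C e_sym eu'v orbT.
case: (reduce_triple uC vC u'C (adj_neq euv) nu (adj_neq eu'v)).
  move=> t; rewrite !inE => /orP[/orP[]|] /eqP->; left.
  - by apply: pf; rewrite inE clnbrs_refl.
  - by apply: pf; rewrite inE clnbrs_refl orbT.
  - by apply: pf'; rewrite inE clnbrs_refl.
have u'N : u' \in clnbrs C u :|: clnbrs C v by rewrite in_setU u'v orbT.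
have vN : v \in clnbrs C u :|: clnbrs C v by rewrite in_setU clnbrs_refl orbT.
have := card_setU_common2 (adj_neq eu'v) u'N (clnbrs_refl C u') vN vu'.
by move: c; rewrite card_clnbrs du'; card_nia.
Qed.

(** A common element [z] would leave at most [(2k+1) + (k+1) - 1 = 3k+1] closed neighbours for [u],
    [v], [v']. *)
Lemma pair_low_disj u v v' z : pair u v -> v' \in low -> v' != v ->
  z \in clnbrs C u :|: clnbrs C v -> z \notin clnbrs C v'.
Proof.
move=> p v'D nv zN; apply/negP=> zv'.
have [uC vC vD du euv] := pairP p; have [v'C dv'] := lowP v'D.
have nu : v' != u.
  by apply: contraTneq v'D => ->; rewrite inE uC du; rewrite gtn_eqF.
have euv' := pair_low_uniq p v'D nv.
case: (reduce_triple uC vC v'C (adj_neq euv) nu nv).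
  move=> t; rewrite !inE => /orP[/orP[]|] /eqP->; right.
  - by exists v'; split; rewrite // !inE eqxx orbT.
  - by exists v'; split; rewrite ?low_indep // !inE eqxx orbT.
  - by exists u; split; rewrite 1?eq_sym 1?e_sym // !inE eqxx.
have := card_setU_common1 zN zv'; have := card_pair p.
by rewrite dv'; card_nia.
Qed.

(** The four vertices together would have at most [4k+1] closed neighbours. Each of them misses a
    vertex of the other pair and has no neighbour in [A], so the degree condition holds. *)
Lemma pair_pair_disj u v u' v' z : pair u v -> pair u' v' -> u' != u ->
  z \in clnbrs C u :|: clnbrs C v -> z \notin clnbrs C u' :|: clnbrs C v'.
Proof.
move=> p p' nuu zN; apply/negP=> zN'.
have [uC vC vD du euv] := pairP p; have [u'C v'C v'D du' eu'v'] := pairP p'.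
have nvv : v' != v.
  by apply: contraNneq nuu => vv; apply/eqP/(@pair_uniq _ _ v) => //; rewrite -vv.
have not_low x y : x \in C -> #|nbrs C x| = k.+1 -> y \in low -> x != y.
  move=> _ dx; apply: contraTneq => <-; rewrite inE dx.
  by rewrite gtn_eqF ?andbF.
have nuv' : u != v' := not_low _ _ uC du v'D.
have nu'v : u' != v := not_low _ _ u'C du' vD.
have euv' := pair_low_uniq p v'D nvv.
have eu'v : ~~ e u' v by apply: pair_low_uniq p' vD _; rewrite eq_sym.
set S := [set u; v] :|: [set u'; v'].
have c4 : #|S| = 4%N.
  rewrite cardsU !cards2 (adj_neq euv) (adj_neq eu'v') /=.
  suff -> : [set u; v] :&: [set u'; v'] = set0 by rewrite cards0.
  apply/setP=> x; rewrite !inE; apply/negP=> /andP[/orP[]/eqP-> /orP[]/eqP xE].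
  - by rewrite xE eqxx in nuu.
  - by rewrite xE eqxx in nuv'.
  - by rewrite xE eqxx in nu'v.
  - by rewrite xE eqxx in nvv.
have SC : S \subset C.
  by apply/subsetP=> x; rewrite !inE => /orP[]/orP[]/eqP->.
case: (@reduce_card S SC).
- by apply/set0Pn; exists u; rewrite !inE eqxx.
- have free x y : x \in S -> y \in S -> y != x -> ~~ e x y ->
    (#|nbrs S x| + 0 <= 2)%N.
    by move=> xS yS nyx exy; have := card_nbrs_lt2 xS yS nyx exy; rewrite c4 addn0 addn1.
  have [uS vS] : u \in S /\ v \in S by rewrite !inE !eqxx !orbT.
  have [u'S v'S] : u' \in S /\ v' \in S by rewrite !inE !eqxx !orbT.
  have pf := pair_card0 p; have pf' := pair_card0 p'.
  move=> x; rewrite !inE => /orP[]/orP[]/eqP->.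
  + by rewrite pf ?inE ?eqxx //; apply: (free u v'); rewrite // eq_sym.
  + by rewrite pf ?inE ?eqxx ?orbT //; apply: (free v v'); rewrite // low_indep.
  + by rewrite pf' ?inE ?eqxx //; apply: (free u' v); rewrite // eq_sym.
  + by rewrite pf' ?inE ?eqxx ?orbT //; apply: (free v' v); rewrite 1?eq_sym // low_indep.
rewrite !clnbrs_setU !clnbrs_set1 c4.
have := card_setU_common1 zN zN'; have := card_pair p; have := card_pair p'.
by move: k_gt0; card_nia.
Qed.

(** With degree [k+1], [x] would extend the pair to a reducible triple, sharing [u] and itself with
    its neighbourhood. *)
Lemma pair_third u v x : pair u v -> x \in C -> x \notin low -> e u x ->
  (k + 1 < #|nbrs C x|)%N.
Proof.
move=> p xC xD eux; have [uC vC vD du euv] := pairP p.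
have := level_mindeg L xC; rewrite leq_eqVlt => /predU1P[kx|].
  by case/negP: xD; rewrite inE xC kx eqxx.
rewrite leq_eqVlt => /predU1P[dx|]; last by rewrite addn1.
have nxv : x != v by apply: contraNneq xD => ->.
have xu : x \in clnbrs C u by rewrite in_clnbrs xC eux orbT.
have ux : u \in clnbrs C x by rewrite in_clnbrs uC e_sym eux orbT.
have nxu : x != u by rewrite eq_sym adj_neq.
case: (reduce_triple uC vC xC (adj_neq euv) nxu nxv).
  have pf := pair_card0 p.
  move=> t; rewrite !inE => /orP[/orP[]|] /eqP->; left; apply: pf;
    rewrite inE ?clnbrs_refl ?orbT //.
  by rewrite xu.
have xN : x \in clnbrs C u :|: clnbrs C v by rewrite in_setU xu.
have uN : u \in clnbrs C u :|: clnbrs C v by rewrite in_setU clnbrs_refl.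
have := card_setU_common2 nxu xN (clnbrs_refl C x) uN ux.
by have := card_pair p; rewrite (card_clnbrs _ x) -dx; card_nia.
Qed.

(** Ensures that [x] keeps degree [k+1] once its low neighbours are removed. The cases are zero, one
    or two low neighbours; three are impossible. *)
Lemma low_nbrs_split x : x \in C -> x \notin low ->
  (forall v, ~~ pair x v) -> (k + #|nbrs low x| < #|nbrs C x|)%N.
Proof.
move=> xC xD np; have := level_mindeg L xC; rewrite leq_eqVlt => /predU1P[kx|kx].
  by case/negP: xD; rewrite inE xC kx eqxx.
have [->|] := posnP #|nbrs low x|; first by rewrite addn0.
case/card_gt0P=> v1 v1x; have := v1x; rewrite in_nbrs => /andP[D1 e1].
have dx : (k.+1 < #|nbrs C x|)%N.
  by rewrite ltn_neqAle kx andbT eq_sym; apply: contra (np v1) => dx; apply/and4P.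
rewrite (cardsD1 v1) v1x.
have [->|] := posnP #|nbrs low x :\ v1|; first by rewrite addn0 addn1.
case/card_gt0P=> v2 v2x; have := v2x; rewrite in_setD1 in_nbrs => /and3P[n21 D2 e2].
rewrite (cardsD1 v2) v2x.
have [->|] := posnP #|nbrs low x :\ v1 :\ v2|.
  by have := low_nbrs_two xC D2 D1 n21 e2 e1; card_nia.
case/card_gt0P=> v3; rewrite !in_setD1 in_nbrs => /and4P[n32 n31 D3 e3].
by case: (@low_nbrs_lt3 x v2 v1 v3).
Qed.

(** * Stripping low vertices and excluding pairs *)

Lemma wt_pair m : (m + 1 <= 2 * k)%N ->
  2%:R * wt k + m%:R * wt k.+1 <= 2%:R.
Proof.
move=> mk; have := @wt_comb_le 2 m 2 1 k isT; rewrite divr1; apply.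
by move: mk k_gt0; card_nia.
Qed.

Lemma sum_two (N Y : {set V}) x y : N \subset C -> x \in N -> y \in N -> x != y ->
  (#|N| <= 2 * k + 1)%N -> N :\: [set x; y] \subset Y ->
  (forall z, z \in Y -> (k.+1 <= #|nbrs Y z|)%N) -> \sum_(z in N) w z <= 2%:R.
Proof.
move=> NC xN yN xy cN NY degY.
have xyN : [set x; y] \subset N by apply/subsetP=> z /set2P[]->.
rewrite (big_setID [set x; y]) /= (setIidPr xyN).
apply: le_trans (@wt_pair #|N :\: [set x; y]| _).
  apply: lerD.
    have -> : 2%:R = #|[set x; y]|%:R :> rat by rewrite cards2 xy.
    by apply: sum_le_card => z /(subsetP xyN)/(subsetP NC); apply: w_core (level_mindeg L) _.
  by apply: sum_le_card => z /(subsetP NY); apply: w_core degY _.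
have := cardsID [set x; y] N; rewrite (setIidPr xyN) cards2 xy.
by move: cN; card_nia.
Qed.

(* Once [semilow] is known to be empty, [C :\: low] has minimum degree at least
   [k + 1]; to prove emptiness one first strips both sets. *)
Definition semilow := [set u in C | [exists v, pair u v]].

Lemma semilowP u : reflect (exists v, pair u v) (u \in semilow).
Proof.
apply: (iffP idP) => [|[v p]]; first by rewrite inE => /andP[_ /existsP].
by have [uC _ _ _ _] := pairP p; rewrite inE uC; apply/existsP; exists v.
Qed.

Lemma mindeg_strip x : x \in C :\: (low :|: semilow) ->
  (k.+1 <= #|nbrs (C :\: (low :|: semilow)) x|)%N.
Proof.
rewrite !in_setD in_setU negb_or => /andP[/andP[xD xE] xC].
set Y := C :\: _; set DE := low :|: semilow.
have : (#|nbrs C x| <= #|nbrs Y x| + #|nbrs DE x|)%N.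
  apply: leq_trans (leq_card_setU _ _); apply: subset_leq_card.
  rewrite -nbrsU; apply: nbrs_subset; apply/subsetP=> z zC.
  by rewrite in_setU in_setD zC andbT orNb.
have [/existsP[u /andP[uE exu]]|noE] := boolP [exists u, (u \in semilow) && e x u].
  have [v p] := semilowP _ uE; have [uC vC vD _ euv] := pairP p.
  have eux : e u x by rewrite e_sym.
  have xN : x \in clnbrs C u :|: clnbrs C v by rewrite in_setU in_clnbrs xC eux orbT.
  have xcl y : y \in C -> e x y -> x \in clnbrs C y.
    by move=> yC exy; rewrite in_clnbrs xC e_sym exy orbT.
  (* A second stripped neighbour of [x] would give a triangle on the pair, or a low vertex or
     another pair whose neighbourhood meets that of the pair at [x]. *)
  have : (#|nbrs DE x| <= 1)%N.
    rewrite -(cards1 u); apply/subset_leq_card/subsetP=> t.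
    rewrite in_nbrs in_set1 => /andP[/setUP[tD|/semilowP[v' p']] ext];
      apply: contraT => tu.
      have [tv|tv] := eqVneq t v.
        by have := pair_no_triangle p xC eux; rewrite -tv e_sym ext.
      by have := pair_low_disj p tD tv xN; rewrite xcl // (subsetP low_sub).
    have [tC _ _ _ _] := pairP p'.
    by have := pair_pair_disj p p' tu xN; rewrite in_setU xcl.
  by have := pair_third p xC xD eux; card_nia.
have : (#|nbrs DE x| <= #|nbrs low x|)%N.
  apply/subset_leq_card/subsetP=> t.
  rewrite !in_nbrs in_setU => /andP[/orP[->//|tE] ext].
  by case/existsP: noE; exists t; rewrite tE.
have np v : ~~ pair x v by apply: contra xE => p; apply/semilowP; exists v.
by have := low_nbrs_split xC xD np; card_nia.
Qed.

(** By disjointness, the other closed neighbours of the pair lie in the stripped set, where weights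
    are at most [wt k.+1]. This improvement makes the pair reducible. *)
Lemma pair_false u v : ~ pair u v.
Proof.
move=> p; have [uC vC vD du euv] := pairP p.
have uv := adj_neq euv; set N := clnbrs C u :|: clnbrs C v.
have SC : [set u; v] \subset C by apply/subsetP=> z /set2P[]->.
have NE : N = clnbrs_set C [set u; v] by rewrite clnbrs_setU !clnbrs_set1.
have [uN vN] : u \in N /\ v \in N by split; rewrite in_setU clnbrs_refl ?orbT.
case: (reduce SC).
- by apply/set0Pn; exists u; rewrite !inE eqxx.
- move=> x xS; have lt2 := card_nbrs_lt xS; rewrite cards2 uv in lt2.
  have xN : x \in N by rewrite NE (subsetP (sub_clnbrs_set _ _)).
  by rewrite (pair_card0 p xN) addn0 ltnW.
rewrite cards2 uv -NE (pair_attached p) cards0 mul0r addr0.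
apply: sum_two uN vN uv (card_pair p) _ mindeg_strip.
  by rewrite NE clnbrs_set_sub.
apply/subsetP=> z; rewrite in_setD in_set2 negb_or => /andP[/andP[zu zv] zN].
rewrite in_setD in_setU negb_or -andbA; apply/and3P; split.
- apply/negP=> zD; have := pair_low_disj p zD zv zN.
  by rewrite clnbrs_refl.
- apply/negP=> /semilowP[v' p']; have := pair_pair_disj p p' zu zN.
  by rewrite in_setU clnbrs_refl.
- by move: zN; rewrite NE; apply/subsetP/clnbrs_set_sub.
Qed.

(** * Passing to the next minimum degree *)

Lemma mindeg_core x : x \in C :\: low -> (k.+1 <= #|nbrs (C :\: low) x|)%N.
Proof.
have E0 : semilow = set0.
  by apply/setP=> u; rewrite in_set0; apply/semilowP=> -[v /pair_false].
by have := @mindeg_strip x; rewrite E0 setU0.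
Qed.

Lemma nbrs_low v : v \in low -> nbrs C v \subset C :\: low.
Proof.
move=> vD; apply/subsetP=> x; rewrite in_nbrs in_setD => /andP[-> evx].
by rewrite andbT; apply: contraL evx => xD; apply: low_indep.
Qed.

Lemma core_set0 : C :\: low = set0 -> C = set0.
Proof.
move=> core0; have [//|[v vC]] := set_0Vmem C.
have vD : v \in low by apply: contraT => vD; have := in_set0 v; rewrite -core0 in_setD vD vC.
have := subset_leq_card (nbrs_low vD); rewrite core0 cards0.
by have [_] := lowP vD; rewrite card_clnbrs => -[->]; rewrite leqNgt k_gt0.
Qed.

(** The neighbours of a low vertex all lie in the core, so only [v] itself is charged [wt k]. *)
Lemma reduce_low v : v \in low ->
  ~ wt k + k%:R * wt k.+1 <= 1 + #|attached (clnbrs C v)|%:R / 4%:R.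
Proof.
move=> vD le1; have [vC dv] := lowP vD.
have SC : [set v] \subset C by rewrite sub1set.
case: (reduce SC).
- by apply/set0Pn; exists v; rewrite inE.
- move=> x xS; have := card_nbrs_lt xS; rewrite cards1 ltnS leqn0 => /eqP->.
  by rewrite add0n ltnW // ltnS (level_attach L) // (subsetP SC).
rewrite cards1 clnbrs_set1; apply: le_trans le1.
apply: le_trans (sum_setU_le w_ge0 _ _) _; rewrite big_set1 lerD //.
  exact: (w_core (level_mindeg L)).
move: dv; rewrite card_clnbrs => -[dv]; rewrite -{1}dv.
by apply: sum_le_card => x /(subsetP (nbrs_low vD)); apply: w_core mindeg_core _.
Qed.

Lemma low_attached0 v : v \in low -> attached (clnbrs C v) = set0.
Proof.
move=> vD; apply/eqP; rewrite -cards_eq0 -leqn0 leqNgt; apply/negP=> att.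
(* One attached vertex raises the allowance from 1 to [5/4], which suffices for every positive
   [k]. *)
apply: (reduce_low vD); apply: (@le_trans _ _ (5%:R / 4%:R)); last first.
  by move: att; rewrite -(ler_nat rat); lra.
have := @wt_comb_le 1 k 5 4 k isT; rewrite mul1r; apply.
by move: k_gt0; card_nia.
Qed.

(** Two low vertices with a common neighbour have at most [2k+1] closed neighbours, all but those
    two in the core, so [sum_two] makes them reducible. *)
Lemma low_attach u : u \in C -> (#|nbrs low u| <= 1)%N.
Proof.
move=> uC; rewrite leqNgt; apply/negP=> /card_gt1P[x [y []]].
rewrite !in_nbrs => /andP[xD eux] /andP[yD euy] xy.
have [[xC dx] [yC dy]] := (lowP xD, lowP yD).
set N := clnbrs C x :|: clnbrs C y.
have SC : [set x; y] \subset C by apply/subsetP=> z /set2P[]->.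
have NE : N = clnbrs_set C [set x; y] by rewrite clnbrs_setU !clnbrs_set1.
have [xN yN] : x \in N /\ y \in N by split; rewrite in_setU clnbrs_refl ?orbT.
case: (reduce SC).
- by apply/set0Pn; exists x; rewrite !inE eqxx.
- move=> z zS; have lt2 := card_nbrs_lt zS; rewrite cards2 xy ltnS in lt2.
  exact: leq_add lt2 (level_attach L (subsetP SC z zS)).
rewrite cards2 xy -NE; apply: (@le_trans _ _ 2%:R); last first.
  by rewrite lerDl divr_ge0.
apply: sum_two xN yN xy _ _ mindeg_core.
- by rewrite NE clnbrs_set_sub.
- have ux : u \in clnbrs C x by rewrite in_clnbrs uC e_sym eux orbT.
  have uy : u \in clnbrs C y by rewrite in_clnbrs uC e_sym euy orbT.
  by have := card_setU_common1 ux uy; rewrite dx dy; card_nia.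
- apply/subsetP=> z; rewrite in_setD in_set2 negb_or => /andP[/andP[zx zy]].
  rewrite in_setU !in_setU1 (negPf zx) (negPf zy) /=.
  by case/orP; apply/subsetP/nbrs_low.
Qed.

Lemma low_set0 : (3 <= k)%N -> low = set0.
Proof.
move=> k3; have [//|[v vD]] := set_0Vmem low; case: (reduce_low vD).
apply: (@le_trans _ _ 1); last by rewrite lerDl divr_ge0.
(* This inequality amounts to [3k >= 8], which is why 3 is the threshold. *)
have := @wt_comb_le 1 k 1 1 k isT; rewrite mul1r divr1; apply.
by move: k3; card_nia.
Qed.

Lemma level_high : (3 <= k)%N -> level k.+1 C A.
Proof.
move=> /low_set0 D0; have := mindeg_core; rewrite D0 setD0 => deg.
by case: L => ? ? _; split.
Qed.

Lemma level_next : (k <= 2)%N -> level k.+1 (C :\: low) (low :|: A).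
Proof.
move=> k2.
have no_att v x a : v \in low -> x \in clnbrs C v -> a \in A -> ~~ e a x.
  move=> vD xv aA; apply/negP=> eax; have := in_set0 a.
  rewrite -(low_attached0 vD) inE aA; case/existsP; exists x.
  by rewrite xv eax.
have leCa a : (#|nbrs (C :\: low) a| <= #|nbrs C a|)%N.
  by rewrite subset_leq_card // nbrs_subset // subsetDl.
split.
- rewrite setUA [_ :|: low]setUC -(level_part L).
  by congr (_ :|: A); rewrite -{1}(setIidPr low_sub) setID.
- apply/pred0P=> x /=; rewrite in_setD in_setU.
  case: (x \in low) => //=; have [xC|//] := boolP (x \in C).
  by rewrite (disjointFr (level_disj L) xC).
- exact: mindeg_core.
- move=> a /setUP[aD|aA]; apply/setP=> x; rewrite in_set0 in_nbrs in_setU;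
    apply/negP=> /andP[/orP[xD|xA] eax].
  + by have := low_indep aD xD; rewrite eax.
  + by have := no_att a a x aD (clnbrs_refl C a) xA; rewrite e_sym eax.
  + by have := no_att x x a xD (clnbrs_refl C x) aA; rewrite eax.
  + by have := in_set0 x; rewrite -(level_indep L aA) in_nbrs xA eax.
- move=> u; rewrite in_setD => /andP[_ uC]; rewrite nbrsU.
  have [->|[v]] := set_0Vmem (nbrs low u); first by rewrite set0U (level_attach L).
  (* Since [u] lies in the closed neighbourhood of the low vertex [v], nothing in [A] is attached to
     it. *)
  rewrite in_nbrs => /andP[vD euv]; have -> : nbrs A u = set0.
    apply/setP=> a; rewrite in_set0 in_nbrs; apply/negP=> /andP[aA eua].
    have := no_att v u a vD _ aA; rewrite e_sym eua in_clnbrs uC e_sym euv orbT.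
    by move/(_ isT).
  by rewrite setU0 low_attach.
- move=> a aDA; apply: (@leq_trans #|nbrs C a|); first exact: leCa.
  case/setUP: aDA => [|aA]; last by have := level_deg2 L aA.
  by rewrite inE => /andP[_ /eqP->].
- move=> a u /setUP[aD|aA] ua; last first.
    have uCa := subsetP (nbrs_subset a (subsetDl C low)) u ua.
    apply: le_trans (level_cost L aA uCa); rewrite lerD2l.
    by apply: sum_subset_le; rewrite // setSD // nbrs_subset // subsetDl.
  have [aC da] := lowP aD; rewrite card_clnbrs in da; case: da => da.
  have le_s : \sum_(x in nbrs (C :\: low) a :\ u) w x <= (k - 1)%N%:R * wt k.+1.
    apply: le_trans (sum_le_card _) _.
      move=> x; rewrite in_setD1 in_nbrs => /and3P[_ xY _].
      exact: (w_core mindeg_core xY).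
    apply: ler_wpM2r; first by rewrite divr_ge0.
    rewrite ler_nat; have := cardsD1 u (nbrs (C :\: low) a); rewrite ua.
    by move: (leCa a); rewrite da; card_nia.
  apply: le_trans (lerD (w_core (level_mindeg L) aC) le_s) _.
  (* The left side is exactly [3/4] for [k = 1] and [51/70] for [k = 2]; it would exceed [3/4] for
     [k = 3]. *)
  have := @wt_comb_le 1 (k - 1) 3 4 k isT; rewrite mul1r; apply.
  by move: k2 k_gt0; clear; case: k => [|[|[|]]].
Qed.

End Level.

(** * Climbing the levels until the core is empty *)

Lemma level_ge3_set0 k C A : level k C A -> (3 <= k)%N -> C = set0.
Proof.
(* The same [C] passes to every higher level, so a vertex in it would have more than [#|V|]
   neighbours. *)
move=> L k3; have Ln n : level (n + k) C A.
  by elim: n => // n Ln; apply: level_high Ln _ _; move: k3; card_nia.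
have [//|[v vC]] := set_0Vmem C.
have := level_mindeg (Ln #|V|) vC; have := max_card (mem (nbrs C v)).
by move: k3; card_nia.
Qed.

Lemma level_start : level 1 X set0.
Proof.
have nbrs0 x : nbrs set0 x = set0 by apply/setP=> y; rewrite !inE.
split; first exact: setU0.
- by apply/pred0P=> x; rewrite /= inE andbF.
- move=> v vX; rewrite lt0n cards_eq0; apply/eqP=> nX.
  (* An isolated vertex is reducible because its weight is capped at 1. *)
  apply: (@X_irr [set v] [set v]); rewrite ?sub1set ?set11 ?big_set1 ?cards1 //.
  + by apply/set0Pn; exists v; rewrite inE.
  + by move=> x xS; have := card_nbrs_lt xS; rewrite cards1 ltnS leqn0 => /eqP->.
  + by move=> x; rewrite inE => /eqP->; rewrite nX sub0set.
- by move=> a; rewrite in_set0.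
- by move=> u _; rewrite nbrs0 cards0.
- by move=> a; rewrite in_set0.
- by move=> a u; rewrite in_set0.
Qed.

Lemma irreducible_set0 : X = set0.
Proof.
have L1 := level_start; have L2 := level_next L1 isT isT.
have L3 := level_next L2 isT isT.
apply: (core_set0 L1 isT); apply: (core_set0 L2 isT).
exact: level_ge3_set0 L3 isT.
Qed.

End Irreducible.

(** * Induction on the vertex set *)

Lemma exists_2independent (X : {set V}) : exists S : {set V},
  [/\ S \subset X, forall x, x \in S -> (#|nbrs S x| <= 2)%N &
      \sum_(x in X) w x <= #|S|%:R].
Proof.
have [n] := ubnP #|X|; elim: n X => // n IHn X; rewrite ltnS => leXn.
pose good (S : {set V}) := [&& S \subset X, [forall x in S, #|nbrs S x| <= 2]%N &
  \sum_(x in X) w x <= #|S|%:R].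
have [/existsP[S /and3P[SX /forall_inP deg le_w]]|no_good] := boolP [exists S, good S].
  by exists S.
(* If no solution exists, any violation of irreducibility combines with a solution on [X :\: T] into
   one on [X]. Thus [X] is irreducible, hence empty, and the empty set solves it. *)
have /irreducible_set0-> : irreducible X.
  move=> S T ST TX T0 deg nT le_w; case/existsP: no_good.
  have [|S' [S'XT deg' le_w']] := IHn (X :\: T).
    apply: leq_trans leXn; have := cardsID T X; rewrite (setIidPr TX).
    by move: T0; rewrite -card_gt0; card_nia.
  have S'X := subset_trans S'XT (subsetDl X T).
  have no_edge x y : x \in S -> y \in S' -> ~~ e x y.
    move=> xS yS'; apply/negP=> exy; have := subsetP S'XT y yS'.
    by rewrite in_setD (subsetP (nT x xS)) // in_nbrs (subsetP S'X).
  exists (S :|: S'); apply/and3P; split.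
  - by rewrite subUset (subset_trans ST TX).
  - apply/forall_inP=> x /setUP[xS|xS']; rewrite nbrsU.
      have -> : nbrs S' x = set0.
        apply/setP=> y; rewrite in_set0 in_nbrs.
        by apply/andP=> -[/(no_edge x y xS)/negP].
      by rewrite setU0 deg.
    have -> : nbrs S x = set0.
      apply/setP=> y; rewrite in_set0 in_nbrs e_sym.
      by apply/andP=> -[/no_edge/(_ xS')/negP].
    by rewrite set0U deg'.
  - have SS' : [disjoint S & S'].
      rewrite disjoint_sym; apply/pred0P=> x /=; apply/andP=> -[/(subsetP S'XT)].
      by rewrite in_setD => /andP[/negP xT _] /(subsetP ST).
    rewrite cardsU (_ : S :&: S' = set0) ?cards0 ?subn0; last first.
      by apply/eqP; rewrite setI_eq0.
    by rewrite natrD (big_setID T) /= (setIidPr TX) lerD.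
by exists set0; split=> [||]; rewrite ?sub0set ?big_set0 // => x; rewrite inE.
Qed.

End Graph.

(** * Relating [zeta] to induced subgraphs *)

Section Coreness.
Variable G : sgraph.

Lemma edge_set2 (x y : G) : ([set x; y] \in edges G) = adj x y.
Proof.
rewrite inE; apply/existsP/idP => [[a /existsP[b /andP[ab /eqP xy]]]|xy]; last first.
  by exists x; apply/existsP; exists y; rewrite xy eqxx.
have [xab yab] : x \in [set a; b] /\ y \in [set a; b] by rewrite -xy !inE !eqxx orbT.
have [aS bS] : a \in [set x; y] /\ b \in [set x; y] by rewrite xy !inE !eqxx orbT.
have ab' : a != b by apply: contraTneq ab => ->; rewrite adj_irr.
case/set2P: xab (xab) => xE _; subst x.
  case/set2P: yab => [yE|->//]; subst y.
  by case/set2P: bS ab' => ->; rewrite eqxx.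
case/set2P: yab => [->|yE]; first by rewrite adj_sym.
by subst y; case/set2P: aS ab' => ->; rewrite eqxx.
Qed.

Lemma degree_induced (Y : {set G}) x : x \in Y ->
  degree (induced Y) x = #|nbrs (@adj G) Y x|.
Proof.
move=> xY; apply: eq_card => y; rewrite in_set /= in_set edge_set2 in_nbrs.
by rewrite subUset !sub1set xY andbC.
Qed.

Lemma zeta_core k (Y : {set G}) :
  (forall v, v \in Y -> k <= #|nbrs (@adj G) Y v|) ->
  forall v, v \in Y -> k <= zeta v.
Proof.
move=> deg v vY; have sub : is_subgraph (induced Y) && (v \in (induced Y).1).
  rewrite vY andbT; apply/andP; split.
    by apply/subsetP=> f; rewrite inE => /andP[].
  by apply/forall_inP=> f; rewrite inE => /andP[].
apply: (@leq_trans (min_degree (induced Y))); last first.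
  exact: (leq_bigmax_cond (F := @min_degree G) _ sub).
rewrite /min_degree; elim/big_ind: _ => [|a b ka kb|x xY].
(* The default value of [min_degree] must also reach [k]; it bounds the degree of [v], which is at
   least [k]. *)
- exact: leq_trans (deg v vY) (max_card _).
- by rewrite leq_min ka.
- by rewrite degree_induced // deg.
Qed.

End Coreness.

(** * The bound on the 2-independence number *)

Local Open Scope ring_scope.

Theorem theorem7 (G : sgraph) (hG : (0 < #|{: G}|)%N) :
  (alpha 2 G)%:R >= Z3 G.
Proof.
pose w (v : G) : rat := Num.min 1 (1 / ((zeta v)%:R + 1 / 3%:R)).
have pos (k : nat) : 0 < k%:R + 1 / 3%:R :> rat by rewrite ltr_wpDl.
have w_ge0 v : 0 <= w v by rewrite le_min ler01 divr_ge0 ?ltW.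
have w_le1 v : w v <= 1 by rewrite ge_min lexx.
have w_core (k : nat) (Y : {set G}) :
    (forall v, v \in Y -> (k <= #|nbrs (@adj G) Y v|)%N) ->
    forall v, v \in Y -> w v <= wt k.
  move=> deg v vY; have kz := zeta_core deg vY; rewrite ge_min; apply/orP; right.
  have -> : wt k = 1 / (k%:R + 1 / 3%:R).
    rewrite /wt natrD natrM; have := pos k; set x := k%:R => x0.
    by field; lra.
  by rewrite ler_pM2l // lef_pV2 ?posrE // lerD2r ler_nat.
have [S [_ deg le_w]] :=
  exists_2independent (@adj_sym G) (@adj_irr G) w_ge0 w_le1 w_core setT.
have -> : Z3 G = \sum_(v in setT) w v by apply: eq_bigl => v; rewrite inE.
apply: le_trans le_w _; rewrite ler_nat.
apply: (leq_bigmax_cond (F := fun S : {set G} => #|S|)).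
by apply/bigmax_leqP=> x xS; rewrite degree_induced // deg.
Qed.
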